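(* Let $\alpha\in[0,1)$ and let $G$ be a connected graph of order $n$ that is not transmission regular. Then \[ T_{\max}(G)-\mu_{\alpha}(G)>\frac{(1-\alpha)\,n\,T_{\max}(G)\,\bigl(nT_{\max}(G)-2\sigma(G)\bigr)}{(1-\alpha)\,n^2\,T_{\max}(G)+4\sigma(G)\bigl(nT_{\max}(G)-2\sigma(G)\bigr)}. \]
   Context: All graphs are finite, simple and undirected; $d_G(u,v)$ is the distance between $u$ and $v$ in the connected graph $G$. The transmission of a vertex $u$ is $T_G(u)=\sum_{v\in V(G)}d_G(u,v)$; $T_{\max}(G)$ is the maximum of $T_G(u)$ over all vertices $u$; $\sigma(G)=\frac12\sum_{v\in V(G)}T_G(v)$ is the sum of the distances over all unordered pairs of vertices. $G$ is transmission regular if $T_G(v)$ is the same for all $v\in V(G)$. Let $T(G)$ be the diagonal matrix of transmissions and $D(G)=(d_G(u,v))_{u,v\in V(G)}$ the distance matrix. For $\alpha\in[0,1)$, $D_{\alpha}(G)=\alpha T(G)+(1-\alpha)D(G)$, and $\mu_{\alpha}(G)$ (the distance $\alpha$-spectral radius) is the largest eigenvalue of the symmetric matrix $D_{\alpha}(G)$. *)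

(* Defs.v *)
From mathcomp Require Import all_boot all_order all_algebra.
From mathcomp Require Import classical_sets reals.

Set Implicit Arguments.
Unset Strict Implicit.
Unset Printing Implicit Defensive.

Import Order.TTheory GRing.Theory Num.Theory.
Local Open Scope ring_scope.

(* A graph is given by a finite vertex type V and an adjacency relation
   e : rel V, assumed symmetric and irreflexive where it is used. *)

Definition connected_graph (V : finType) (e : rel V) : Prop :=
  forall u v : V, connect e u v.

(* Here path e u p is the walk u :: p with size p edges. In a connected graph a
   shortest walk repeats no vertex, so its length is < #|V|; the default value
   #|V| is reached only when v is not reachable from u. *)
Definition dist (V : finType) (e : rel V) (u v : V) : nat :=
  \big[minn/#|V|]_(k < #|V| |
      [exists p : k.-tuple V, path e u p && (last u p == v)]) k.

Definition transmission (V : finType) (e : rel V) (u : V) : nat :=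
  (\sum_(v : V) dist e u v)%N.

Definition Tmax (V : finType) (e : rel V) : nat :=
  (\max_(u : V) transmission e u)%N.

Definition sigma (R : realType) (V : finType) (e : rel V) : R :=
  2^-1 * \sum_(v : V) (transmission e v)%:R.

Definition transmission_regular (V : finType) (e : rel V) : Prop :=
  forall u v : V, transmission e u = transmission e v.

(* Matrices are indexed by 'I_#|V|, with enum_val : 'I_#|V| -> V. *)
Definition transmission_matrix (R : realType) (V : finType) (e : rel V) :
    'M[R]_#|V| :=
  diag_mx (\row_i (transmission e (enum_val i))%:R).

Definition distance_matrix (R : realType) (V : finType) (e : rel V) :
    'M[R]_#|V| :=
  \matrix_(i, j) (dist e (enum_val i) (enum_val j))%:R.

Definition Dalpha (R : realType) (alpha : R) (V : finType) (e : rel V) :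
    'M[R]_#|V| :=
  alpha *: transmission_matrix R e + (1 - alpha) *: distance_matrix R e.

(* A nonempty real symmetric matrix has a largest eigenvalue, so the default
   value 0 is never used for such a matrix. *)
Definition largest_eigenvalue (R : realType) (n : nat) (A : 'M[R]_n) : R :=
  xget 0 [set a | eigenvalue A a /\ forall b, eigenvalue A b -> b <= a]%classic.

Definition mu (R : realType) (alpha : R) (V : finType) (e : rel V) : R :=
  largest_eigenvalue (Dalpha alpha e).

(* Main.v *)
(** Let [x] be an eigenvector for [mu], [z = |x|], [N = sum z^2], [M = max z],
    [y = min z], [s = 2 sigma], [S = n Tmax - s] and [a = (1 - alpha) n].
    Writing [(Tmax - mu) N] as a sum of squares and using [d >= 1] off the
    diagonal gives [(Tmax - mu) N >= S y^2 + (a / 2) (M - y)^2], whose minimum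
    over [y] is [K M^2] with [K = a S / (2 S + a)].  On the other hand
    [mu N <= s M^2].  Eliminating [M^2] yields [Tmax - mu >= Tmax K / (s + K)],
    which is the claimed bound since [s + S = n Tmax].  Equality in the second
    estimate forces [y = M], which is not the minimizer in the first.
    Passing to [|x|] replaces the Perron vector, so any eigenvalue will do. *)

Require Import Defs.
From mathcomp Require Import all_boot all_order all_algebra.
From mathcomp Require Import reals.
From mathcomp Require Import boolp classical_sets ring lra.

Import Order.TTheory GRing.Theory Num.Theory.
Local Open Scope ring_scope.

Lemma dist_sym (V : finType) (e : rel V) :
  symmetric e -> forall u v, dist e u v = dist e v u.
Proof.
move=> e_sym.
have walk_rev u v (k : nat) :
    [exists p : k.-tuple V, path e u p && (last u p == v)] ->
    [exists p : k.-tuple V, path e v p && (last v p == u)].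
  case/existsP => p /andP[pth /eqP lst]; apply/existsP.
  (* Dropping the end [v] from [u :: p] and reversing leaves the vertices that follow [v] on the way
     back to [u]. *)
  have szp : size (rev (belast u p)) == k by rewrite size_rev size_belast size_tuple.
  exists (Tuple szp) => /=; rewrite -{1}lst rev_path.
  rewrite (eq_path (e' := e)) ?pth /=; last by move=> a b; exact: e_sym.
  by case: (tval p) lst => [/= -> //|b q] _ /=; rewrite rev_cons last_rcons.
by move=> u v; apply: eq_bigl => k; apply/idP/idP; exact: walk_rev.
Qed.

Lemma dist_gt0 (V : finType) (e : rel V) (u v : V) : u != v -> (0 < dist e u v)%N.
Proof.
move=> neq; rewrite /dist; elim/big_ind: _ => [|m n|k].
(* The default value [#|V|] of the minimum also has to be positive; [u] witnesses this. *)
- by apply/card_gt0P; exists u.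
- by rewrite leq_min => -> ->.
- case/existsP => p /andP[_ /eqP lst]; rewrite lt0n; apply: contra neq => /eqP k0.
  have /size0nil p0 : size p = 0%N by rewrite size_tuple.
  by rewrite -lst p0.
Qed.

Section WeightedForm.
Variables (R : realFieldType) (I : finType).
Implicit Types (d : I -> I -> R) (z : I -> R).

Lemma sum_sqr_diff z :
  \sum_i \sum_j (z i - z j) ^+ 2 =
  2 * #|I|%:R * \sum_i z i ^+ 2 - 2 * (\sum_i z i) ^+ 2.
Proof.
have inner i : \sum_j (z i - z j) ^+ 2 =
    #|I|%:R * z i ^+ 2 - 2 * z i * (\sum_j z j) + \sum_j z j ^+ 2.
  under eq_bigr => j _ do rewrite sqrrB -mulrnAl.
  by rewrite !big_split /= sumr_const sumrN -mulr_sumr !mulr_natl.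
under eq_bigr => i _ do rewrite inner.
rewrite !big_split /= sumr_const sumrN -mulr_sumr -mulr_suml -mulr_sumr.
by rewrite -[_ *+ _]mulr_natl; ring.
Qed.

(** Centring [z] at its mean [c] keeps all differences and turns the double sum into [2 n] times the
    sum of [(z i - c)^2]. Keeping only the terms at [u] and [v], and using
    [2 (p^2 + q^2) >= (p - q)^2], gives the factor [n]. *)
Lemma sum_sqr_diff_ge z (u v : I) :
  #|I|%:R * (z u - z v) ^+ 2 <= \sum_i \sum_j (z i - z j) ^+ 2.
Proof.
have n_gt0 : 0 < #|I|%:R :> R by rewrite ltr0n; apply/card_gt0P; exists u.
have [->|neq] := eqVneq u v.
  rewrite subrr expr0n mulr0; apply: sumr_ge0 => i _.
  by apply: sumr_ge0 => j _; exact: sqr_ge0.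
pose c := (\sum_i z i) / #|I|%:R.
have centered : \sum_i (z i - c) = 0.
  rewrite big_split /= sumr_const -mulr_natl /c; field.
  by rewrite gt_eqF.
have -> : \sum_i \sum_j (z i - z j) ^+ 2 =
    \sum_i \sum_j ((z i - c) - (z j - c)) ^+ 2.
  by apply: eq_bigr => i _; apply: eq_bigr => j _; congr (_ ^+ 2); ring.
rewrite (sum_sqr_diff (fun i => z i - c)) centered expr0n mulr0 subr0.
rewrite -[2 * _ * _]mulrA [leRHS]mulrCA ler_pM2l //.
rewrite (bigD1 u) //= (bigD1 v) /=; last by rewrite eq_sym.
have : 0 <= \sum_(i | (i != u) && (i != v)) (z i - c) ^+ 2.
  by apply: sumr_ge0 => i _; exact: sqr_ge0.
have := sqr_ge0 (z u + z v - 2 * c); nra.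
Qed.

Lemma sum_row_sum_sqr d z :
  \sum_i (\sum_j d i j) * z i ^+ 2 = \sum_i \sum_j d i j * z i ^+ 2.
Proof. by apply: eq_bigr => i _; rewrite mulr_suml. Qed.

Lemma dirichlet_form d z : (forall i j, d i j = d j i) ->
  \sum_i \sum_j d i j * (z i - z j) ^+ 2 =
  2 * (\sum_i (\sum_j d i j) * z i ^+ 2 - \sum_i \sum_j d i j * (z i * z j)).
Proof.
move=> d_sym.
have swap : \sum_i \sum_j d i j * z j ^+ 2 = \sum_i \sum_j d i j * z i ^+ 2.
  by rewrite exchange_big; apply: eq_bigr => i _; apply: eq_bigr => j _; rewrite d_sym.
transitivity (\sum_i \sum_j d i j * z i ^+ 2 + \sum_i \sum_j d i j * z j ^+ 2
              - 2 * \sum_i \sum_j d i j * (z i * z j)).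
  rewrite mulr_sumr -sumrN -!big_split; apply: eq_bigr => i _ /=.
  rewrite mulr_sumr -sumrN -!big_split; apply: eq_bigr => j _ /=; ring.
by rewrite swap sum_row_sum_sqr; ring.
Qed.

(** This is the bound with its denominator cleared, for any [lam] satisfying the Rayleigh-type
    inequality at a nonnegative nonzero [z]. The graph enters only through the weights [d]. *)
Lemma weighted_form_gap (alpha Tm lam : R) d z :
  0 <= alpha -> alpha < 1 ->
  (forall i j, d i j = d j i) -> (forall i j, 0 <= d i j) ->
  (forall i j, i != j -> 1 <= d i j) ->
  (forall i, \sum_j d i j <= Tm) ->
  0 < \sum_i \sum_j d i j -> \sum_i \sum_j d i j < #|I|%:R * Tm ->
  (forall i, 0 <= z i) -> 0 < \sum_i z i ^+ 2 ->
  lam * \sum_i z i ^+ 2 <=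
    alpha * (\sum_i (\sum_j d i j) * z i ^+ 2)
    + (1 - alpha) * \sum_i \sum_j d i j * (z i * z j) ->
  let n := #|I|%:R in
  let s := \sum_i \sum_j d i j in
  let S := n * Tm - s in
  ((1 - alpha) * n * S * lam <
    (2 * S + (1 - alpha) * n) * s * (Tm - lam) : Prop).
Proof.
move=> a0 a1 d_sym d_ge0 d_ge1 rowT s_gt0 s_lt z0 N_gt0 lamF n s S.
have [i0 _|noI] := pickP (fun _ : I => true); last first.
  by move: N_gt0; rewrite big1 ?ltxx // => i _; have := noI i.
(* [z u] and [z v] are the extreme values [M] and [y] of the overview. *)
pose u := [arg max_(i > i0) z i]%O; pose v := [arg min_(i < i0) z i]%O.
have zM i : z i <= z u by rewrite /u; case: arg_maxP => // k _; exact.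
have zm i : z v <= z i by rewrite /v; case: arg_minP => // k _; exact.
set F := (X in _ <= X) in lamF; set N := \sum_i z i ^+ 2 in N_gt0 lamF.
pose a : R := (1 - alpha) * n.
have S_gt0 : 0 < S by rewrite subr_gt0.
have alpha'_gt0 : 0 < 1 - alpha by rewrite subr_gt0.
have n_gt0 : 0 < n by rewrite /n ltr0n; apply/card_gt0P; exists i0.
have a_gt0 : 0 < a by exact: mulr_gt0.
have zu_gt0 : 0 < z u.
  rewrite lt_neqAle z0 andbT; apply/eqP => zu0.
  move: N_gt0; rewrite /N big1 ?ltxx // => i _.
  have := zM i; rewrite -zu0 => zi; have -> : z i = 0 by apply/le_anti; rewrite zi z0.
  by rewrite expr0n.
(* [2 (Tm N - F)] is twice the sum of [(Tm - row sum) * z i ^+ 2] plus [1 - alpha] times the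
   Dirichlet form; [deficit] and [energy] bound the two pieces from below. *)
have lower : 2 * S * z v ^+ 2 + a * (z u - z v) ^+ 2 <= 2 * (Tm - lam) * N.
  have energy : n * (z u - z v) ^+ 2 <= \sum_i \sum_j d i j * (z i - z j) ^+ 2.
    apply: le_trans (sum_sqr_diff_ge z u v) _.
    apply: ler_sum => i _; apply: ler_sum => j _.
    have [->|neq] := eqVneq i j; first by rewrite subrr expr0n mulr0.
    by rewrite ler_peMl ?sqr_ge0 ?d_ge1.
  have deficit : S * z v ^+ 2 <= Tm * N - \sum_i (\sum_j d i j) * z i ^+ 2.
    have -> : S = \sum_i (Tm - \sum_j d i j).
      by rewrite big_split /= sumr_const sumrN -mulr_natl.
    rewrite mulr_suml /N mulr_sumr -sumrN -big_split /=; apply: ler_sum => i _.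
    rewrite -mulrBl ler_wpM2l ?subr_ge0 ?rowT //.
    by rewrite ler_pXn2r // nnegrE.
  rewrite dirichlet_form // in energy.
  have := ler_wpM2l (ltW alpha'_gt0) energy.
  rewrite /a; move: lamF deficit; rewrite /F.
  set A := \sum_i _ * _; set B := \sum_i \sum_j d i j * (_ * _).
  set D := (z u - z v) ^+ 2; lra.
(* [F] is the [d]-weighted sum of these convex combinations, so an entrywise bound suffices for
   [upper]. *)
have entry i j : alpha * z i ^+ 2 + (1 - alpha) * (z i * z j) <= z u ^+ 2.
  have -> : z u ^+ 2 = alpha * z u ^+ 2 + (1 - alpha) * (z u * z u) by ring.
  apply: lerD; first by rewrite ler_wpM2l // ler_pXn2r // nnegrE.
  by apply: ler_wpM2l; [exact: ltW | exact: ler_pM].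
have F_sum : F = \sum_i \sum_j d i j * (alpha * z i ^+ 2 + (1 - alpha) * (z i * z j)).
  rewrite /F sum_row_sum_sqr !mulr_sumr -big_split; apply: eq_bigr => i _ /=.
  by rewrite !mulr_sumr -big_split; apply: eq_bigr => j _ /=; ring.
have s_sum : s * z u ^+ 2 = \sum_i \sum_j d i j * z u ^+ 2.
  by rewrite /s mulr_suml; apply: eq_bigr => i _; rewrite mulr_suml.
have upper : F <= s * z u ^+ 2.
  rewrite F_sum s_sum; apply: ler_sum => i _; apply: ler_sum => j _.
  by rewrite ler_wpM2l.
(* Completing the square in [z v]: the left side of [lower] is minimal where
   [2 S z v = a (z u - z v)], and the last square measures the distance from that point. *)
have square_id : (2 * S + a) * (2 * S * z v ^+ 2 + a * (z u - z v) ^+ 2) =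
    2 * a * S * z u ^+ 2 + (2 * S * z v - a * (z u - z v)) ^+ 2 by ring.
have c_gt0 : 0 < 2 * S + a by lra.
have scaled := ler_wpM2l (ltW c_gt0) lower.
rewrite square_id in scaled.
rewrite -/a -(ltr_pM2r N_gt0).
have lamFu := ler_wpM2l (ltW (mulr_gt0 a_gt0 S_gt0)) lamF.
(* The chain is [a S lam N <= a S F <= a S s (z u)^2 <= s (2 S + a) (Tm - lam) N]. If [z] is
   constant, the completed square is [(2 S z u)^2 > 0], so the last link is strict; otherwise the
   middle one is. *)
have [zuv|neq] := eqVneq (z v) (z u).
  have sq_gt0 : 0 < (2 * S * z v - a * (z u - z v)) ^+ 2.
    by rewrite zuv subrr mulr0 subr0 exprn_gt0 // !mulr_gt0.
  have upper' := ler_wpM2l (ltW (mulr_gt0 a_gt0 S_gt0)) upper.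
  have strict : a * S * z u ^+ 2 < (2 * S + a) * ((Tm - lam) * N) by lra.
  rewrite -(ltr_pM2l s_gt0) -/s in strict.
  lra.
have neq_vu : v != u by apply: contraNneq neq => ->.
have lt_vu : z v < z u by rewrite lt_neqAle neq zm.
(* Strictness comes from the single entry [(v, u)]: its weight is at least 1 and
   [z v * z u < z u ^+ 2]. *)
have F_lt : F < s * z u ^+ 2.
  rewrite F_sum s_sum (bigD1 v) //= [ltRHS](bigD1 v) //=.
  apply: ltr_leD; last first.
    by apply: ler_sum => i _; apply: ler_sum => j _; rewrite ler_wpM2l.
  rewrite (bigD1 u) 1?eq_sym //= [ltRHS](bigD1 u) 1?eq_sym //=.
  apply: ltr_leD; last by apply: ler_sum => j _; rewrite ler_wpM2l.
  rewrite ltr_pM2l; last exact: lt_le_trans ltr01 (d_ge1 _ _ neq_vu).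
  have -> : z u ^+ 2 = alpha * z u ^+ 2 + (1 - alpha) * (z u * z u) by ring.
  apply: ler_ltD; first by rewrite ler_wpM2l // ler_pXn2r // nnegrE.
  by rewrite ltr_pM2l // ltr_pM2r.
have upper' : a * S * (lam * N) < a * S * (s * z u ^+ 2).
  by rewrite ltr_pM2l ?mulr_gt0 //; exact: le_lt_trans lamF F_lt.
have weak : a * S * z u ^+ 2 <= (2 * S + a) * ((Tm - lam) * N).
  by have := sqr_ge0 (2 * S * z v - a * (z u - z v)); lra.
have := ler_wpM2l (ltW s_gt0) weak.
rewrite -/s; lra.
Qed.

End WeightedForm.

Theorem theorem3p5 (R : realType) (alpha : R)
    (halpha0 : 0 <= alpha) (halpha1 : alpha < 1)
    (V : finType) (e : rel V)
    (e_sym : symmetric e) (e_irr : irreflexive e)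
    (e_conn : connected_graph e)
    (e_nreg : ~ transmission_regular e) :
  let n : R := #|V|%:R in
  let Tm : R := (Tmax e)%:R in
  let s : R := sigma R e in
  (1 - alpha) * n * Tm * (n * Tm - 2 * s)
    / ((1 - alpha) * n ^+ 2 * Tm + 4 * s * (n * Tm - 2 * s))
  < Tm - mu alpha e.
Proof.
have T_le v : (transmission e v <= Tmax e)%N by rewrite /Tmax leq_bigmax.
(* Non-regularity is used twice: a vertex below the maximum will give [S > 0], and one with nonzero
   transmission will give [s2 > 0]. *)
have [v0 T_lt] : exists v, (transmission e v < Tmax e)%N.
  apply: contra_notP e_nreg => all_max u v.
  have maxE w : transmission e w = Tmax e.
    apply/eqP; rewrite eqn_leq T_le /= leqNgt; apply/negP => lt_w.
    by apply: all_max; exists w.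
  by rewrite !maxE.
have [w0 T_gt0] : exists w, (0 < transmission e w)%N.
  apply: contra_notP e_nreg => all0 u v.
  have zeroE w : transmission e w = 0%N.
    by apply/eqP; rewrite -leqn0 leqNgt; apply/negP => gt0; apply: all0; exists w.
  by rewrite !zeroE.
pose d (i j : 'I_#|V|) : R := (dist e (enum_val i) (enum_val j))%:R.
have d_sym i j : d i j = d j i by rewrite /d dist_sym.
have rowE i : \sum_j d i j = (transmission e (enum_val i))%:R.
  by rewrite /transmission natr_sum (reindex _ (onW_bij _ (enum_val_bij V))).
pose s2 : R := \sum_i \sum_j d i j.
have s2E : s2 = \sum_v (transmission e v)%:R.
  rewrite (reindex _ (onW_bij _ (enum_val_bij V))) /=.
  by apply: eq_bigr => i _; exact: rowE.
have s2_gt0 : 0 < s2.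
  by rewrite s2E (bigD1 w0) //= ltr_wpDr ?ltr0n // sumr_ge0.
have s2_lt : s2 < #|V|%:R * (Tmax e)%:R.
  rewrite s2E mulr_natl -sumr_const (bigD1 v0) //= [ltRHS](bigD1 v0) //=.
  by rewrite ltr_leD ?ltr_nat // ler_sum // => i _; rewrite ler_nat.
cbv zeta; set n : R := #|V|%:R; set Tm : R := (Tmax e)%:R; set s := sigma R e.
have sE : 2 * s = s2 by rewrite /s /sigma s2E mulrA divff ?mul1r // pnatr_eq0.
have -> : 4 * s = 2 * s2 by rewrite -sE; ring.
rewrite sE.
have n_gt0 : 0 < n by rewrite ltr0n; apply/card_gt0P; exists v0.
have Tm_gt0 : 0 < Tm by rewrite ltr0n (leq_ltn_trans _ T_lt).
have S_gt0 : 0 < n * Tm - s2 by rewrite subr_gt0.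
have alpha'_gt0 : 0 < 1 - alpha by rewrite subr_gt0.
have p_gt0 : 0 < (1 - alpha) * n ^+ 2 * Tm by rewrite !mulr_gt0 // exprn_gt0.
have q_gt0 : 0 < 2 * s2 * (n * Tm - s2) by rewrite !mulr_gt0.
rewrite ltr_pdivrMr ?addr_gt0 //.
rewrite /mu /largest_eigenvalue; case: xgetP => [lam _ [eigen _]|_]; last first.
  (* The junk value [mu = 0]: the claimed bound is below [Tmax] anyway, so the
     existence of a largest eigenvalue is not an issue. *)
  have := mulr_gt0 Tm_gt0 q_gt0.
  have := mulr_gt0 (mulr_gt0 (mulr_gt0 alpha'_gt0 n_gt0) Tm_gt0) s2_gt0.
  lra.
have /eigenvalueP[x xA x_neq0] := eigen.
have xE j : alpha * ((\sum_i d j i) * x 0 j) + (1 - alpha) * (\sum_i d j i * x 0 i)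
    = lam * x 0 j.
  have /(congr1 (fun y : 'rV[R]_#|V| => y 0 j)) := xA.
  rewrite /Dalpha mulmxDr -!scalemxAr mul_mx_diag !mxE => <-.
  rewrite rowE [x 0 j * _]mulrC; congr (_ + _ * _); apply: eq_bigr => i _.
  by rewrite !mxE mulrC /d dist_sym.
have abs_le i j : d i j * (x 0 i * x 0 j) <= d i j * (`|x 0 i| * `|x 0 j|).
  by rewrite ler_wpM2l ?ler0n // -normrM ler_norm.
have absx_sqr i : `|x 0 i| ^+ 2 = x 0 i ^+ 2 by rewrite real_normK ?num_real.
have N_gt0 : 0 < \sum_i `|x 0 i| ^+ 2.
  have /rV0Pn[k xk] := x_neq0.
  rewrite (bigD1 k) //= ltr_wpDr ?exprn_gt0 ?normr_gt0 // sumr_ge0 // => i _.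
  exact: exprn_ge0.
(* Multiply the eigenvalue equation at [i] by [x 0 i] and sum; absolute values keep the squares and
   can only increase the products. *)
have quad : lam * \sum_i `|x 0 i| ^+ 2 <=
    alpha * (\sum_i (\sum_j d i j) * `|x 0 i| ^+ 2)
    + (1 - alpha) * \sum_i \sum_j d i j * (`|x 0 i| * `|x 0 j|).
  rewrite !mulr_sumr -big_split; apply: ler_sum => i _ /=.
  rewrite absx_sqr expr2 [lam * _]mulrA -xE mulrDl -!mulrA lerD2l ler_pM2l //.
  rewrite mulr_suml; apply: ler_sum => j _.
  by rewrite -mulrA [x 0 j * _]mulrC; exact: abs_le.
have d_ge0 i j : 0 <= d i j by rewrite ler0n.
have d_ge1 i j : i != j -> 1 <= d i j.
  by move=> neq; rewrite ler1n dist_gt0 // (inj_eq enum_val_inj).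
have row_le i : \sum_j d i j <= Tm by rewrite rowE ler_nat.
have s2_lt' : s2 < #|'I_#|V| |%:R * Tm by rewrite card_ord.
(* Since [n * Tm = s2 + S], subtracting [a S (Tm - lam)] from both sides of the goal leaves exactly
   this inequality. *)
have := weighted_form_gap _ _ _ _ lam _ _ halpha0 halpha1 d_sym d_ge0 d_ge1
  row_le s2_gt0 s2_lt' (fun i => normr_ge0 _) N_gt0 quad.
rewrite card_ord -/s2 -/n => gap; cbv zeta in gap; lra.
Qed.
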